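(* Let $A$ be a connected Alexander quandle. A relation $\sim$ on $A$ is a quandle congruence if and only if there exists a $\mathbb{Z}[t,t^{-1}]$-submodule $D$ of $A$ such that for all $x,y\in A$, $x\sim y\Leftrightarrow y-x\in D$.
   Context: An Alexander quandle is a module $A$ over $\mathbb{Z}[t,t^{-1}]$ with the quandle operation $x\vartriangleright y=tx+(1-t)y$; its inverse operation is $x\vartriangleleft y=t^{-1}x+(1-t^{-1})y$. A quandle $Q$ is connected if it consists of a single orbit under the group of permutations of $Q$ generated by all right translations $x\mapsto x\vartriangleright y$, $y\in Q$ (for an Alexander quandle this is equivalent to $(1-t)A=A$). A quandle congruence on $Q$ is an equivalence relation $\sim$ such that $a\sim c$ and $b\sim d$ imply both $a\vartriangleright b\sim c\vartriangleright d$ and $a\vartriangleleft b\sim c\vartriangleleft d$. *)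

(* Defs.v *)
From HB Require Import structures.
From mathcomp Require Import all_boot all_order all_algebra.
From mathcomp Require Import boolp.

Set Implicit Arguments.
Unset Strict Implicit.
Unset Printing Implicit Defensive.

Import GRing.Theory.
Local Open Scope ring_scope.

(* Z[t, t^-1], as the subring of Frac(Z[X]) of the elements that become
   polynomials after multiplication by a power of X. *)
Definition laurent_pred : {pred {fraction {poly int}}} :=
  fun x => `[< exists (n : nat) (p : {poly int}), x * tofrac 'X ^+ n = tofrac p >].

Lemma laurentP x : reflect
  (exists (n : nat) (p : {poly int}), x * tofrac 'X ^+ n = tofrac p)
  (x \in laurent_pred).
Proof. exact: asboolP. Qed.

Lemma laurent_subring_closed : subring_closed laurent_pred.
Proof.
split.
- by apply/laurentP; exists 0%N, 1; rewrite expr0 mulr1 rmorph1.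
- move=> x y /laurentP[n [p xp]] /laurentP[m [q yq]]; apply/laurentP.
  exists (n + m)%N, (p * 'X ^+ m - q * 'X ^+ n).
  by rewrite rmorphB !rmorphM !rmorphXn /= -xp -yq mulrBl exprD mulrA
             -!mulrA [_ ^+ m * _]mulrC.
- move=> x y /laurentP[n [p xp]] /laurentP[m [q yq]]; apply/laurentP.
  by exists (n + m)%N, (p * q); rewrite rmorphM /= -xp -yq exprD mulrACA.
Qed.

HB.instance Definition _ :=
  GRing.isSubringClosed.Build {fraction {poly int}} laurent_pred
    laurent_subring_closed.

Record laurent := Laurent {
  laurent_val : {fraction {poly int}};
  laurent_valP : laurent_val \in laurent_pred }.

HB.instance Definition _ := [isSub for laurent_val].
HB.instance Definition _ := [Choice of laurent by <:].
HB.instance Definition _ := [SubChoice_isSubComNzRing of laurent by <:].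

Lemma laurentX_subproof : tofrac 'X \in laurent_pred.
Proof. by apply/laurentP; exists 0%N, 'X; rewrite expr0 mulr1. Qed.

Lemma tofracX_neq0 : tofrac ('X : {poly int}) != 0.
Proof. by rewrite tofrac_eq0 polyX_eq0. Qed.

Lemma laurentXV_subproof : (tofrac 'X)^-1 \in laurent_pred.
Proof.
by apply/laurentP; exists 1%N, 1; rewrite expr1 mulVf ?rmorph1 ?tofracX_neq0.
Qed.

Definition lau_t : laurent := Laurent laurentX_subproof.
Definition lau_tV : laurent := Laurent laurentXV_subproof.

Lemma lau_tVK : lau_tV * lau_t = 1.
Proof. by apply/val_inj; rewrite rmorphM rmorph1 /= mulVf ?tofracX_neq0. Qed.

Lemma lau_tKV : lau_t * lau_tV = 1.
Proof. by rewrite mulrC lau_tVK. Qed.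

Record quandle := Quandle {
  qcarrier :> Type;
  rhd : qcarrier -> qcarrier -> qcarrier;
  lhd : qcarrier -> qcarrier -> qcarrier;
  rhd_idem : forall x, rhd x x = x;
  rhdK : forall y, cancel (rhd^~ y) (lhd^~ y);
  lhdK : forall y, cancel (lhd^~ y) (rhd^~ y);
  rhd_distr : forall x y z, rhd (rhd x y) z = rhd (rhd x z) (rhd y z) }.

(* The group of permutations generated by the right translations. *)
Inductive inner (Q : quandle) : (Q -> Q) -> Prop :=
| inner_trans y : inner (fun x => rhd x y)
| inner_id : inner id
| inner_comp f g : inner f -> inner g -> inner (f \o g)
| inner_inv f g : inner f -> cancel f g -> cancel g f -> inner g.

Definition orbit (Q : quandle) (x y : Q) : Prop :=
  exists2 f, inner f & f x = y.

Definition connected (Q : quandle) : Prop :=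
  exists x : Q, forall y : Q, orbit x y.

Definition congruence (Q : quandle) (r : Q -> Q -> Prop) : Prop :=
  RelationClasses.Equivalence r /\
  forall a b c d : Q, r a c -> r b d ->
    r (rhd a b) (rhd c d) /\ r (lhd a b) (lhd c d).

Section Alexander.
Variable A : lmodType laurent.

Definition alex_rhd (x y : A) : A := lau_t *: x + (1 - lau_t) *: y.
Definition alex_lhd (x y : A) : A := lau_tV *: x + (1 - lau_tV) *: y.

Lemma alex_idem x : alex_rhd x x = x.
Proof. by rewrite /alex_rhd -scalerDl addrC subrK scale1r. Qed.

Lemma alex_rhdK y : cancel (alex_rhd^~ y) (alex_lhd^~ y).
Proof.
move=> x; rewrite /alex_lhd /alex_rhd scalerDr !scalerA lau_tVK scale1r.
by rewrite mulrBr mulr1 lau_tVK -addrA -scalerDl addrA subrK subrr scale0r addr0.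
Qed.

Lemma alex_lhdK y : cancel (alex_lhd^~ y) (alex_rhd^~ y).
Proof.
move=> x; rewrite /alex_lhd /alex_rhd scalerDr !scalerA lau_tKV scale1r.
by rewrite mulrBr mulr1 lau_tKV -addrA -scalerDl addrA subrK subrr scale0r addr0.
Qed.

Lemma alex_distr x y z :
  alex_rhd (alex_rhd x y) z = alex_rhd (alex_rhd x z) (alex_rhd y z).
Proof.
rewrite /alex_rhd !scalerDr !scalerA addrACA -scalerDl.
rewrite [(1 - lau_t) * lau_t]mulrC; congr (_ + _ *: _).
by rewrite -mulrDl [lau_t + _]addrC subrK mul1r.
Qed.

Definition alexander : quandle :=
  Quandle alex_idem alex_rhdK alex_lhdK alex_distr.

(* GRing.submod_closed for Prop-valued, not necessarily decidable, subsets. *)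
Definition submodule (D : A -> Prop) : Prop :=
  D 0 /\ forall (a : laurent) (u v : A), D u -> D v -> D (a *: u + v).

End Alexander.

(* Main.v *)
Require Import Defs.
From mathcomp Require Import all_boot all_order all_algebra.
Import GRing.Theory.
Local Open Scope ring_scope.

(** Connectedness forces [(1 - t) A = A].  Given a congruence, the map
    [x |-> (x rhd d) lhd 0] is the translation by [t^-1 (1 - t) d]; since [1 - t]
    is onto, every translation of [A] has this form, so the congruence is
    translation invariant and is determined by the class [D] of [0].  This class
    is an additive subgroup by translation invariance, and it is stable under [t]
    and [t^-1], which are the maps [x |-> x rhd 0] and [x |-> x lhd 0].  The
    scalars that stabilise an additive subgroup form a subring, and [t], [t^-1]
    generate [Z[t, t^-1]] as a ring, so [D] is a submodule.  Conversely both
    quandle operations are linear in the pair of arguments, hence compatible with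
    the cosets of any submodule. *)

(** The numerator is handled by Horner's scheme; the power of [t] in the
    denominator is then removed by a power of [t^-1]. *)
Lemma laurent_subring_ind (P : laurent -> Prop) :
    P 1 -> (forall a b, P a -> P b -> P (a - b)) ->
    (forall a b, P a -> P b -> P (a * b)) ->
    P lau_t -> P lau_tV -> forall a, P a.
Proof.
move=> P1 PB PM Pt PtV a.
have P0 : P 0 by rewrite -(subrr 1); exact: PB.
have PN b : P b -> P (- b) by move=> Pb; rewrite -sub0r; exact: PB.
have PD b c : P b -> P c -> P (b + c).
  by move=> Pb Pc; rewrite -[c]opprK; apply: PB => //; exact: PN.
have Pnat n : P n%:R by elim: n => // n IHn; rewrite -natr1; exact: PD.
have Pint (z : int) : P z%:~R by case: z => n; [|apply: PN]; exact: Pnat.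
have Ppoly p : exists2 b : laurent, val b = tofrac p & P b.
  elim/poly_ind: p => [|p c [b bp Pb]].
    by exists 0; rewrite ?rmorph0.
  exists (b * lau_t + c%:~R); last by apply: PD; [exact: PM | exact: Pint].
  have -> : c%:P = (c%:~R : {poly int}) by rewrite -[c in LHS]intz rmorph_int.
  by rewrite !rmorphD !rmorphM !rmorph_int /= bp.
have [n [p ap]] := laurentP _ (valP a).
have [b bp Pb] := Ppoly p.
have -> : a = b * lau_tV ^+ n.
  have <- : a * lau_t ^+ n = b.
    by apply/val_inj; rewrite rmorphM rmorphXn /= ap -bp.
  by rewrite -mulrA -exprMn lau_tKV expr1n mulr1.
apply: (PM) => //; elim: n {ap} => [|n IHn]; first by rewrite expr0.
by rewrite exprS; exact: PM.
Qed.

Section AlexanderCongruences.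
Variable A : lmodType laurent.

(** A right translation moves [x] to [x + (1 - t) (y - x)]; composites and
    inverses preserve this form, so an orbit stays in one coset of
    [(1 - t) A]. *)
Lemma inner_displacement (f : A -> A) :
  @inner (alexander A) f -> forall x, exists d, f x - x = (1 - lau_t) *: d.
Proof.
elim=> {f} [y|| f g _ IHf _ IHg | f g _ IHf fK gK] x.
- exists (y - x); rewrite /= /alex_rhd scalerBr addrAC.
  by rewrite addrC [(1 - _) *: x]scalerBl scale1r opprB.
- by exists 0; rewrite subrr scaler0.
- have [d fd] := IHf (g x); have [e ge] := IHg x.
  by exists (d + e); rewrite scalerDr -fd -ge /= addrA subrK.
- have [d fd] := IHf (g x); exists (- d).
  by rewrite scalerN -fd gK opprB.
Qed.

Lemma connected_1subt_surj : connected (alexander A) ->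
  forall y : A, exists d, y = (1 - lau_t) *: d.
Proof.
case=> x x_orb y; have [f inf fx] := x_orb (x + y).
have [d fd] := inner_displacement _ inf x.
by exists d; rewrite -fd fx addrC addKr.
Qed.

Lemma submodule_congruence (D : A -> Prop) : submodule D ->
  @congruence (alexander A) (fun x y => D (y - x)).
Proof.
case=> D0 DZD.
have DD u v : D u -> D v -> D (u + v).
  by move=> Du Dv; rewrite -[u]scale1r; exact: DZD.
have DZ a u : D u -> D (a *: u).
  by move=> Du; rewrite -[_ *: _]addr0; exact: DZD.
have Dlin a b (u v u' v' : A) : D (u' - u) -> D (v' - v) ->
    D (a *: u' + b *: v' - (a *: u + b *: v)).
  move=> Du Dv; rewrite opprD addrACA -!scalerBr.
  by apply: DD; exact: DZ.
split; last by move=> a b c d Dac Dbd; split; exact: Dlin.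
split=> [x | x y Dxy | x y z Dxy Dyz].
- by rewrite subrr.
- by rewrite -opprB -scaleN1r; exact: DZ.
- by rewrite -(subrK y z) -addrA; exact: DD.
Qed.

Section ZeroClass.
Variable r : A -> A -> Prop.
Hypothesis connA : connected (alexander A).
Hypothesis congr : @congruence (alexander A) r.

(** Acting by [d] on the right and undoing the factor [t] with [0] instead of [d]
    leaves a translation by [t^-1 (1 - t) d], so [d] is chosen with
    [(1 - t) d = t c]. *)
Lemma congruence_translate c x y : r x y -> r (x + c) (y + c).
Proof.
have [[refl _ _] compat] := congr => rxy.
have [d td] := connected_1subt_surj connA (lau_t *: c).
have shift z : alex_lhd (alex_rhd z d) 0 = z + c.
  rewrite /alex_lhd /alex_rhd -td scaler0 addr0 -scalerDr scalerA.
  by rewrite lau_tVK scale1r.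
rewrite -!shift.
have [rd _] := compat _ _ _ _ rxy (refl d).
by have [_] := compat _ _ _ _ rd (refl 0).
Qed.

Lemma congruence_zero_class x y : r x y <-> r 0 (y - x).
Proof.
split=> [/(congruence_translate (- x)) | /(congruence_translate x)].
  by rewrite subrr.
by rewrite add0r subrK.
Qed.

(** Only [t] and [t^-1] act through the quandle operations; the other scalars
    are reached by [laurent_subring_ind]. *)
Lemma zero_class_submodule : submodule (r 0).
Proof.
have [[refl sym trans] compat] := congr.
have DD u v : r 0 u -> r 0 v -> r 0 (u + v).
  move=> ru /(congruence_translate u); rewrite add0r addrC.
  exact: trans.
have DN u : r 0 u -> r 0 (- u).
  by move=> /sym /congruence_zero_class; rewrite sub0r.
have Dt u : r 0 u -> r 0 (lau_t *: u) /\ r 0 (lau_tV *: u).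
  move=> ru; have := compat _ _ _ _ ru (refl 0).
  by rewrite /= /alex_rhd /alex_lhd !scaler0 !addr0.
have DZ a : forall u, r 0 u -> r 0 (a *: u).
  elim/laurent_subring_ind: a => [u|a b Da Db u|a b Da Db u|u|u] ru.
  - by rewrite scale1r.
  - by rewrite scalerBl; apply: DD; [exact: Da | apply: DN; exact: Db].
  - by rewrite -scalerA; apply: Da; exact: Db.
  - by case: (Dt u ru).
  - by case: (Dt u ru).
by split=> [|a u v ru rv]; [exact: refl | apply: DD => //; exact: DZ].
Qed.

End ZeroClass.

End AlexanderCongruences.

Theorem mainTheorem6 (A : lmodType laurent) (hA : connected (alexander A))
    (r : A -> A -> Prop) :
  @congruence (alexander A) r <->
  exists D : A -> Prop,
    submodule D /\ forall x y : A, r x y <-> D (y - x).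
Proof.
split=> [congr | [D [subD rD]]].
  exists (r 0); split; first exact: zero_class_submodule.
  exact: congruence_zero_class.
have [[refl sym trans] compat] := submodule_congruence _ _ subD.
split=> [|a b c d /rD Dac /rD Dbd].
  split=> [x | x y /rD Dxy | x y z /rD Dxy /rD Dyz]; apply/rD.
  - exact: refl.
  - exact: sym.
  - exact: trans Dxy Dyz.
by have [? ?] := compat _ _ _ _ Dac Dbd; split; apply/rD.
Qed.
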